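(* Let $R$ be a commutative finite chain ring of nilpotency index $e$ and residue field $\mathbb{F}_q$, and let $n$ be a positive integer. Then $$d_n(R,0)=q^{en^2}\left(1-\prod_{i=0}^{n-1} (1-q^{-e-i})\right).$$
   Context: A commutative finite chain ring is a finite commutative ring with identity $1\neq 0$ whose ideals are linearly ordered by inclusion. Such a ring $R$ has a unique maximal ideal, which is principal; let $\gamma$ be a generator of it. The nilpotency index of $R$ is the smallest positive integer $e$ with $\gamma^e=0$. The residue field of $R$ is the finite field $R/\gamma R$; it is $\mathbb{F}_q$, where $q$ is a prime power. For a commutative ring $S$ and $a\in S$, $d_n(S,a)$ denotes the number of $n\times n$ matrices over $S$ whose determinant is $a$. *)

(* Defs.v *)
From HB Require Import structures.
From mathcomp Require Import all_boot all_order all_algebra.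

Set Implicit Arguments.
Unset Strict Implicit.
Unset Printing Implicit Defensive.

Import GRing.Theory.
Local Open Scope ring_scope.

(* Unlike the library's [idealr], this includes the unit ideal. *)
Definition is_ideal (R : finComNzRingType) (I : {set R}) : Prop :=
  [/\ 0 \in I,
      forall x y, x \in I -> y \in I -> x + y \in I
    & forall a x, x \in I -> a * x \in I].

Definition chain_ring (R : finComNzRingType) : Prop :=
  forall I J : {set R}, is_ideal I -> is_ideal J ->
    (I \subset J) \/ (J \subset I).

Definition maximal_ideal (R : finComNzRingType) (M : {set R}) : Prop :=
  [/\ is_ideal M,
      M <> [set: R]
    & forall J : {set R}, is_ideal J -> M \subset J -> J = M \/ J = [set: R]].

Definition principal (R : finComNzRingType) (g : R) : {set R} :=
  [set g * a | a in [set: R]].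

Definition nilpotency_index (R : finComNzRingType) (g : R) (e : nat) : Prop :=
  [/\ (0 < e)%N, g ^+ e = 0
    & forall k : nat, (0 < k)%N -> g ^+ k = 0 -> (e <= k)%N].

Lemma maximal_principal_idealr (R : finComNzRingType) (g : R) :
  maximal_ideal (principal g) -> idealr_closed (fun x => x \in principal g).
Proof.
move=> [[I0 ID IM] Iproper _]; split=> //.
- apply/negP => I1; apply: Iproper; apply/setP=> x.
  by rewrite [RHS]inE -[x]mulr1; apply: IM.
- by move=> a x y xI yI; apply: ID => //; apply: IM.
Qed.

(* The set [principal g] with the library structure of proper ideal, as
   needed by [{ideal_quot _}]. *)
Definition max_idealr (R : finComNzRingType) (g : R)
    (gmax : maximal_ideal (principal g)) : idealr R :=
  HB.pack (fun x : R => x \in principal g)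
    (isIdealr.Build R (fun x : R => x \in principal g)
      (maximal_principal_idealr gmax)).

Definition residue_field_is (R : finComNzRingType) (g : R)
    (gmax : maximal_ideal (principal g)) (F : fieldType) : Prop :=
  exists f : {rmorphism {ideal_quot (max_idealr gmax)} -> F}, bijective f.

Definition d (n : nat) (S : finComNzRingType) (a : S) : nat :=
  #|[set A : 'M[S]_n | \det A == a]|.
Arguments d n S a : clear implicits.

(* Main.v *)
Require Import Defs.
From mathcomp Require Import all_boot all_order all_algebra.
From mathcomp Require Import perm generic_quotient ring_quotient ring zify.

(** Counting matrices of nonzero determinant directly does not lead to a
    recursion, because factoring [g] out of a column changes the condition on
    the determinant. The quantity that does satisfy one is the number
    N(n, k) of n x n matrices A with [g ^+ k * \det A != 0], where [g]
    generates the maximal ideal; the theorem is about N(n, 0).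

    The recursion comes from looking at the first column v.
    - If some entry of v is a unit, an invertible row operation turns v into
      the first basis vector. The condition then only concerns the lower right
      block of size n - 1, and the other entries of the first row are free.
    - Otherwise v = g w. Then \det A is [g] times the determinant of the
      matrix with first column w, so the exponent k becomes k + 1. Each such v
      comes from q^n columns w, since the annihilator of [g] has q elements.

    Using powers of [g] as multipliers, rather than asking that the determinant
    avoid the ideal generated by a power of [g], makes the second case an
    identity: [g ^+ k * (g * x)] is [g ^+ k.+1 * x].

    With e = j + k, this recursion has the solution
    N(n, k) = |R|^(n^2) \prod_(0 <= i < n) (1 - q^-(j + i)), and the theorem is
    the case k = 0. The chain condition enters only through the fact that an
    element outside the maximal ideal is a unit. The cardinals come from the
    fibres of additive maps: the projection to the residue field and the
    multiplication by [g] give |Ann g| = q, and iterating the latter gives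
    |Ann (g^k)| = q^k for k <= e, hence |R| = q^e. *)

Import GRing.Theory Num.Theory.
Local Open Scope ring_scope.
Local Open Scope quotient_scope.

Set Implicit Arguments.
Unset Strict Implicit.
Unset Printing Implicit Defensive.

(** * Counting fibres and columns *)

(** All nonempty fibres are translates of the kernel. A sum, rather than a
    cardinal, is used so that the same statement serves with weights that count
    the completions of a column to a matrix. *)
Lemma sum_comp_zmod_morphism (U V : finZmodType) (f : U -> V) (F : V -> nat) :
  zmod_morphism f ->
  (\sum_x F (f x) = #|[set x | f x == 0%R]| * \sum_(y in codom f) F y)%N.
Proof.
move=> fB; have f0 : f 0 = 0 by rewrite -(subrr 0) fB subrr.
have fD x y : f (x + y) = f x + f y.
  by rewrite -{1}[y]opprK fB -[- y]sub0r fB f0 sub0r opprK.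
rewrite (partition_big f (mem (codom f))) /=; last first.
  by move=> x _; apply: codom_f.
rewrite big_distrr /=; apply: eq_bigr => _ /codomP[x0 ->].
rewrite (eq_bigr (fun=> F (f x0))) => [|x /eqP-> //].
rewrite sum_nat_const; congr (_ * _)%N.
rewrite -[RHS](card_imset _ (addrI x0)); apply: eq_card => x.
apply/idP/imsetP => [/eqP fx|[z]].
  by exists (x - x0); rewrite ?inE ?fB ?fx ?subrr // addrC subrK.
by rewrite inE => /eqP fz ->; apply/eqP; rewrite fD fz addr0.
Qed.

Lemma card_col_in (R : finType) (S : {set R}) m :
  #|[set v : 'cV[R]_m | [forall i, v i 0 \in S]]| = (#|S| ^ m)%N.
Proof.
pose toc (f : {ffun 'I_m -> R}) : 'cV[R]_m := \col_i f i.
have toc_inj : injective toc.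
  by move=> f h /colP efh; apply/ffunP=> i; have := efh i; rewrite !mxE.
rewrite -[in RHS](card_ord m) -card_ffun_on -(card_imset _ toc_inj).
apply: eq_card => v; rewrite inE.
apply/forallP/imsetP => [vS|[f /ffun_onP fS ->] i].
  exists [ffun i => v i 0]; first by apply/ffun_onP=> i; rewrite ffunE.
  by apply/colP=> i; rewrite mxE ffunE.
by rewrite mxE.
Qed.

Lemma card_mx_by_first_col (R : finType) m n (P : pred 'M[R]_(m, 1 + n)) :
  #|[set A | P A]| =
  (\sum_(v : 'cV[R]_m) #|[set M : 'M_(m, n) | P (row_mx v M)]|)%N.
Proof.
rewrite -sum1_card (partition_big lsubmx xpredT) //=.
apply: eq_bigr => v _; rewrite sum1_card.
have row_inj : injective (@row_mx R m 1 n v) by move=> M M' /eq_row_mx[].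
rewrite -(card_imset _ row_inj); apply: eq_card => A.
apply/andP/imsetP => [[]|[M]]; rewrite inE.
  by move=> PA /eqP <-; exists (rsubmx A); rewrite ?inE hsubmxK.
by move=> PM ->; rewrite inE row_mxKl.
Qed.

(** * Matrices with a unimodular first column *)

Definition card_det_survives (R : finComNzRingType) (g : R) (n k : nat) : nat :=
  #|[set A : 'M[R]_n | g ^+ k * \det A != 0]|.

Lemma inj_row_mx_mulmx (R : comNzRingType) m n (V : 'M[R]_m) c :
  \det V * c = 1 -> injective (fun M : 'M[R]_(m, n) => V *m M).
Proof.
move=> Vc; apply: (can_inj (g := fun M => c *: \adj V *m M)) => M.
by rewrite mulmxA -scalemxAl mul_adj_mx scale_scalar_mx mulrC Vc mul1mx.
Qed.

(** Swapping rows brings the unit entry to the top; the column then completes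
    to a lower triangular matrix with diagonal (unit, 1, ..., 1). The inverse
    [c] of the determinant is carried explicitly because [R] is only a
    commutative ring, without a structure of ring with decidable units. *)
Lemma extend_unimodular_col (R : comNzRingType) n (v : 'cV[R]_(1 + n)) i b :
  v i 0 * b = 1 ->
  exists V : 'M[R]_(1 + n), exists2 c, \det V * c = 1 & col 0 V = v.
Proof.
move=> vib; pose s : 'S_(1 + n) := tperm 0 i.
pose w : 'cV[R]_(1 + n) := xrow 0 i v.
pose V0 : 'M[R]_(1 + n) := row_mx w (col_mx (0 : 'rV_n) 1%:M).
exists (perm_mx s *m V0); exists ((-1) ^+ s * b).
  rewrite det_mulmx det_perm.
  have -> : \det V0 = v i 0.
    rewrite /V0 -[w]vsubmxK -block_mxEh det_lblock det1 mulr1 det_mx11.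
    by rewrite !mxE /= lshift0 tpermL.
  by rewrite mulrACA -signr_addb addbb mul1r.
rewrite -row_permE; apply/colP=> j; rewrite !mxE.
by case: splitP => // l _; rewrite ord1 mxE tpermK.
Qed.

(** Left multiplication by an invertible matrix with first column [v] reduces
    to the case where [v] is the first basis vector; the matrix is then block
    triangular, its top row being free. *)
Lemma card_unimodular_first_col (R : finComNzRingType) (g : R) n k
    (v : 'cV[R]_(1 + n)) i b :
  v i 0 * b = 1 ->
  #|[set M : 'M_(1 + n, n) | g ^+ k * \det (row_mx v M) != 0]| =
  (#|R| ^ n * card_det_survives g n k)%N.
Proof.
move=> /extend_unimodular_col[V [c Vc Vv]].
pose e0 : 'cV[R]_(1 + n) := col_mx 1%:M 0.
have Ve0 : V *m e0 = v.
  have -> : e0 = delta_mx 0 0.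
    apply/colP=> j; rewrite !mxE.
    case: splitP => l jl; rewrite !mxE -(val_eqE j) /= jl //.
    by rewrite !ord1.
  by rewrite -colE.
pose glue (p : 'rV[R]_n * 'M[R]_n) := V *m col_mx p.1 p.2.
have glue_inj : injective glue.
  by move=> [u B] [u' B'] /(inj_row_mx_mulmx Vc)/eq_col_mx[/= -> ->].
have detV p : \det (row_mx v (glue p)) = \det V * \det p.2.
  by rewrite -Ve0 /glue -mul_mx_row det_mulmx -block_mxEh det_ublock det1 mul1r.
pose T := [set B : 'M[R]_n | g ^+ k * \det B != 0].
have -> : [set M | g ^+ k * \det (row_mx v M) != 0]
        = glue @: setX [set: 'rV[R]_n] T.
  apply/setP=> M; rewrite inE; apply/idP/imsetP => [|[p]].
    pose W := c *: \adj V *m M.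
    have -> : M = glue (usubmx W, dsubmx W).
      rewrite /glue /= vsubmxK mulmxA -scalemxAr mul_mx_adj.
      by rewrite scale_scalar_mx mulrC Vc mul1mx.
    rewrite detV => nz; exists (usubmx W, dsubmx W) => //.
    by rewrite !inE /=; apply: contraNneq nz => z; rewrite mulrCA z mulr0.
  rewrite !inE /= => nz ->; rewrite detV; apply: contraNneq nz => z.
  by rewrite -[\det p.2]mul1r -Vc mulrAC mulrA z mul0r.
by rewrite card_imset // cardsX cardsT card_mx mul1n.
Qed.

(** * Cardinals in the chain ring *)

Lemma card_residue_ring (R : finComNzRingType) (g : R) (F : finFieldType)
    (gmax : maximal_ideal (principal g)) :
  residue_field_is gmax F -> #|R| = (#|principal g| * #|F|)%N.
Proof.
case=> f fbij; pose I := max_idealr gmax.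
pose h (x : R) : F := f (\pi_({ideal_quot I}) x).
have hB : zmod_morphism h by move=> x y; rewrite /h !rmorphB.
have := sum_comp_zmod_morphism (fun=> 1%N) hB; rewrite !sum1_card => ->.
congr (_ * _)%N; apply: eq_card => x.
  rewrite inE /h raddf_eq0; last exact: bij_inj.
  by rewrite -(rmorph0 (\pi_{ideal_quot I})) -Quotient.idealrBE subr0.
have [f' _ f'K] := fbij; rewrite [RHS]inE.
by apply/codomP; exists (repr (f' x)); rewrite /h reprK f'K.
Qed.

Lemma mul_zmod_morphism (R : comNzRingType) (g : R) : zmod_morphism ( *%R g).
Proof. by move=> x y; rewrite mulrBr. Qed.

Lemma codom_mul (R : finComNzRingType) (g : R) :
  codom ( *%R g) =i principal g.
Proof.
move=> y; apply/codomP/imsetP => [[x ->]|[x _ ->]].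
  by exists x; rewrite ?inE.
by exists x.
Qed.

(** The kernel and the image of the multiplication by [g] have complementary
    sizes, so the annihilator is as large as the residue ring. *)
Lemma card_annihilator (R : finComNzRingType) (g : R) q :
  (0 < #|principal g|)%N -> #|R| = (#|principal g| * q)%N ->
  #|[set x | g * x == 0]| = q.
Proof.
move=> g_gt0 cR; apply/eqP; rewrite -(eqn_pmul2r g_gt0) [eqbRHS]mulnC -cR.
have := sum_comp_zmod_morphism (fun=> 1%N) (@mul_zmod_morphism R g).
by rewrite !sum1_card (eq_card (codom_mul g)) => ->.
Qed.

Definition local_at (R : finComNzRingType) (g : R) : Prop :=
  forall x, x \notin principal g -> exists y, x * y = 1.

Lemma is_ideal_principal (R : finComNzRingType) (g : R) :
  is_ideal (principal g).
Proof.
split=> [|_ _ /imsetP[a _ ->] /imsetP[b _ ->]|a _ /imsetP[b _ ->]].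
- by apply/imsetP; exists 0; rewrite ?mulr0.
- by rewrite -mulrDr imset_f.
- by rewrite mulrCA imset_f.
Qed.

(** If [x] is not in the ideal of [g], comparability puts the ideal of [x] above
    it, strictly, hence it is the whole ring by maximality. *)
Lemma chain_ring_local (R : finComNzRingType) (g : R) :
  chain_ring R -> maximal_ideal (principal g) -> local_at g.
Proof.
move=> chainR [_ _ gmax] x xNg.
have xx : x \in principal x by apply/imsetP; exists 1; rewrite ?mulr1.
have:= chainR _ _ (is_ideal_principal x) (is_ideal_principal g).
case=> [/subsetP sxg|].
  by rewrite sxg in xNg.
case/(gmax _ (is_ideal_principal x)) => [xg|xT]; first by rewrite -xg xx in xNg.
have: 1 \in principal x by rewrite xT inE.
by case/imsetP=> y _ ->; exists y.
Qed.

(** Multiplication by [g] maps the annihilator of [g ^+ k.+1] onto the part of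
    the annihilator of [g ^+ k] inside the ideal of [g]. That part is all of it,
    as an element outside is a unit and cannot be killed by [g ^+ k != 0]. *)
Lemma card_annihilator_expr (R : finComNzRingType) (g : R) q k :
  local_at g -> #|[set x | g * x == 0]| = q ->
  (forall j, (j < k)%N -> g ^+ j != 0) ->
  #|[set x | g ^+ k * x == 0]| = (q ^ k)%N.
Proof.
move=> locR annq; elim: k => [|k IHk] gk.
  rewrite expr0 (_ : [set _ | _] = [set 0]) ?cards1 //.
  by apply/setP=> x; rewrite !inE mul1r.
rewrite expnS -IHk => [|j /ltnW]; last exact: gk.
rewrite -sum1dep_card big_mkcond /=.
under eq_bigr => x do rewrite exprSr -mulrA.
rewrite (sum_comp_zmod_morphism (fun y => if g ^+ k * y == 0 then 1%N else 0%N)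
  (@mul_zmod_morphism R g)) annq; congr (_ * _)%N.
rewrite -big_mkcondr /= -sum1dep_card; apply: eq_bigl => y.
rewrite codom_mul; case: (boolP (y \in _)) => //= /locR[z yz].
apply/esym/eqP => gky; have /negP[] := gk k (ltnSn k).
by rewrite -[g ^+ k]mulr1 -yz mulrA gky mul0r.
Qed.

(** * The recursion and its solution *)

(** The two summands on the right are the matrices whose first column has a unit
    entry and those whose first column is a multiple of [g]. Multiplying
    through by [q ^ n.+1] accounts for the [q ^ n.+1] ways to divide
    such a column by [g] and keeps the identity in the natural numbers. *)
Lemma card_det_survivesS (R : finComNzRingType) (g : R) q n k :
  local_at g ->
  #|[set x | g * x == 0]| = q ->
  (q ^ n.+1 * card_det_survives g n.+1 k =
   q ^ n.+1 * ((#|R| ^ n.+1 - #|principal g| ^ n.+1)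
                * (#|R| ^ n * card_det_survives g n k))
   + card_det_survives g n.+1 k.+1)%N.
Proof.
move=> locR annq; rewrite /card_det_survives.
rewrite !(@card_mx_by_first_col R n.+1 n (fun A => _ * \det A != 0)).
pose S := [set v : 'cV[R]_n.+1 | [forall i, v i 0 \in principal g]].
rewrite (bigID (mem S)) /= mulnDr addnC; congr (_ + _)%N.
  rewrite (eq_bigr (fun=> #|R| ^ n * card_det_survives g n k)%N) => [|v].
    rewrite sum_nat_const; congr (_ * (_ * _))%N.
    have cT : #|'cV[R]_n.+1| = (#|R| ^ n.+1)%N by rewrite card_mx muln1.
    rewrite -card_col_in -/S -cT -[in RHS](setCK S) -cardsCs.
    by apply: eq_card => v; rewrite in_setC.
  rewrite inE negb_forall => /existsP[i /locR[b vib]].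
  exact: (card_unimodular_first_col g k vib).
pose c (v : 'cV[R]_(1 + n)) :=
  #|[set M : 'M_(1 + n, n) | g ^+ k * \det (row_mx v M) != 0]|.
have scB : zmod_morphism (fun v : 'cV[R]_(1 + n) => g *: v).
  by move=> v w; rewrite scalerBr.
(* Dividing the first column by g trades the weight c, which counts for the
   exponent k, for the one that counts for k + 1. *)
have := sum_comp_zmod_morphism c scB.
have -> : #|[set v : 'cV[R]_(1 + n) | g *: v == 0]| = (q ^ n.+1)%N.
  rewrite -annq -card_col_in; apply: eq_card => v; rewrite !inE.
  apply/eqP/forallP => [/colP gv i|gv].
    by have := gv i; rewrite inE !mxE => ->.
  by apply/colP=> i; have := gv i; rewrite inE !mxE => /eqP.
rewrite [X in (_ * X)%N](eq_bigl (mem S)) => [<-|v].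
  apply: eq_bigr => v _; apply: eq_card => M; rewrite !inE.
  have -> : row_mx (g *: v) M = row_mx v M *m block_mx g%:M 0 0 1%:M.
    rewrite -[row_mx v M]/(row_mx v M : 'M_(1 + n, 1 + n)) mul_row_block.
    by rewrite !mulmx0 addr0 add0r mulmx1 mul_mx_scalar.
  by rewrite det_mulmx det_ublock det1 mulr1 det_scalar1 exprSr mulrA mulrAC.
rewrite !inE; apply/codomP/forallP => [[w ->] i|vS].
  by rewrite mxE imset_f.
have /fin_all_exists[w vw] i : exists x, v i 0 = g * x.
  by have /imsetP[x _ ->] := vS i; exists x.
by exists (\col_i w i); apply/colP=> i; rewrite !mxE.
Qed.

Lemma prodB_recurrence (K : fieldType) (q : K) j n :
  \prod_(0 <= i < n.+1) (1 - q ^- (j.+1 + i)) =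
  (1 - q ^- n.+1) * \prod_(0 <= i < n) (1 - q ^- (j.+1 + i))
  + q ^- n.+1 * \prod_(0 <= i < n.+1) (1 - q ^- (j + i)).
Proof.
rewrite big_nat_recr //= [in RHS]big_nat_recl //=.
under [X in q ^- _ * (_ * X)]eq_bigr => i _ do rewrite addnS -addSn.
rewrite addn0 addSnnS exprD invfM; ring.
Qed.

(** The exponent [j = e - k] is a parameter so that the recursion, which raises
    [k], becomes an induction on [j]. The excluded case [n = j = 0] is the only
    one where the formula fails: the empty determinant 1 is killed by
    [g ^+ e = 0] while the empty product is 1. *)
Lemma card_det_survives_formula (R : finComNzRingType) (g : R) q e n j k :
  local_at g -> #|[set x | g * x == 0]| = q ->
  #|R| = (#|principal g| * q)%N -> (0 < q)%N ->
  g ^+ e = 0 -> (forall i, (i < e)%N -> g ^+ i != 0) ->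
  (j + k)%N = e -> (0 < n + j)%N ->
  (card_det_survives g n k)%:R =
    #|R|%:R ^+ (n ^ 2) * \prod_(0 <= i < n) (1 - q%:R ^- (j + i)) :> rat.
Proof.
move=> locR annq cRg q_gt0 ge0 gnz.
have q0 : q%:R != 0 :> rat by rewrite pnatr_eq0 -lt0n.
elim: n j k => [|n IHn] j k.
  case: j => // j jk _; rewrite big_geq // mulr1 expr0 /card_det_survives.
  rewrite (_ : [set _ | _] = [set: 'M_0]) ?cardsT ?card_mx //.
  apply/setP=> A; rewrite !inE det_mx00 mulr1 gnz //.
  by rewrite -jk addSn ltnS leq_addl.
elim: j k => [k ke _|j IHj k jk _].
  rewrite big_nat_recl //= addn0 expr0 invr1 subrr mul0r mulr0.
  rewrite /card_det_survives (_ : [set _ | _] = set0) ?cards0 //.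
  by apply/setP=> A; rewrite !inE -[k]add0n ke ge0 mul0r eqxx.
have YX : (#|principal g| ^ n.+1 <= #|R| ^ n.+1)%N.
  by rewrite leq_exp2r // max_card.
have := congr1 (fun m => m%:R : rat) (card_det_survivesS n k locR annq).
rewrite /= natrD !natrM natrB // !natrX.
rewrite (IHn j.+1) ?addnS // (IHj k.+1) ?addnS -?addSn //.
rewrite prodB_recurrence cRg natrM !exprMn => eqN.
have qn0 : q%:R ^+ n.+1 != 0 :> rat by rewrite expf_neq0.
apply: (mulfI qn0); rewrite eqN.
have -> : (n.+1 ^ 2 = n.+1 + n + n ^ 2)%N by rewrite !expnS; lia.
by rewrite !exprD; field.
Qed.

Theorem theorem3p8 (R : finComNzRingType) (gamma : R) (e q n : nat)
    (F : finFieldType)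
    (chainR : chain_ring R)
    (gamma_max : maximal_ideal (principal gamma))
    (gamma_nilp : nilpotency_index gamma e)
    (resF : residue_field_is gamma_max F)
    (cardF : #|F| = q)
    (n_gt0 : (0 < n)%N) :
  (d n R 0)%:R =
    q%:R ^+ (e * n ^ 2) * (1 - \prod_(0 <= i < n) (1 - q%:R ^- (e + i)))
  :> rat.
Proof.
have locR := chain_ring_local chainR gamma_max.
have [e_gt0 ge0 e_min] := gamma_nilp.
have gnz i : (i < e)%N -> gamma ^+ i != 0.
  case: i => [_|i lt_ie]; first by rewrite expr0 oner_eq0.
  by apply/eqP=> /(e_min i.+1 isT); rewrite leqNgt lt_ie.
have cRg := card_residue_ring resF; rewrite cardF in cRg.
have g_gt0 : (0 < #|principal gamma|)%N.
  by apply/card_gt0P; exists 0; case: (is_ideal_principal gamma).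
have annq := card_annihilator g_gt0 cRg.
have cRe : #|R| = (q ^ e)%N.
  rewrite -(card_annihilator_expr locR annq gnz) -cardsT.
  by apply: eq_card => x; rewrite !inE ge0 mul0r eqxx.
have q_gt0 : (0 < q)%N by rewrite -cardF; apply/card_gt0P; exists 0.
have total : #|'M[R]_n| = (d n R 0%R + card_det_survives gamma n 0)%N.
  rewrite /d -(cardsC [set A : 'M[R]_n | \det A == 0]); congr (_ + _)%N.
  by apply: eq_card => A; rewrite !inE mul1r.
have := congr1 (fun m => m%:R : rat) total.
have survivors :=
  card_det_survives_formula locR annq cRg q_gt0 ge0 gnz (addn0 e).
rewrite /= natrD survivors; last by rewrite addn_gt0 n_gt0.
rewrite card_mx natrX cRe natrX -!exprM mulnn => /eqP.
by rewrite -subr_eq => /eqP <-; rewrite mulrBr mulr1.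
Qed.
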